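(* Let $n\ge m$ and let $\mathcal{C}=\{A_1,\dots,A_L\}$ be a set of real symmetric $m\times m$ matrices. The following statements are equivalent: (i) $\mathcal{C}$ is $\mathbf{D}_{m,n}$-SD. (ii) There exist $X\in\mathrm{RSL}(m,n)$ and a set $\mathcal{S}$ of real symmetric $n\times n$ matrices such that $\mathcal{S}$ is SD and $\rho_X(\mathcal{S})=\mathcal{C}$. (iii) There exists a set $\mathcal{S}$ of real symmetric $n\times n$ matrices such that $\mathcal{S}$ is SD and $\rho_{I_{m,n}}(\mathcal{S})=\mathcal{C}$.
   Context: $\mathrm{SL}_m(\mathbb{R})$ is the group of real $m\times m$ matrices with determinant $1$. For $n\ge m$, $\mathrm{RSL}(m,n)=\{P\in\mathbb{R}^{n\times m}:P^{\mathsf T}P\in\mathrm{SL}_m(\mathbb{R})\}$, and $I_{m,n}=[e_1,\dots,e_m]\in\mathbb{R}^{n\times m}$ consists of the first $m$ standard basis vectors of $\mathbb{R}^n$. For $X\in\mathbb{R}^{n\times m}$, $\rho_X:\mathbb{R}^{n\times n}\to\mathbb{R}^{m\times m}$ is the map $B\mapsto X^{\mathsf T}BX$, and $\rho_X(\mathcal{S})$ denotes the image of $\mathcal{S}$. A set $\mathcal{S}$ of real symmetric $n\times n$ matrices is SD if there is $P\in\mathrm{SL}_n(\mathbb{R})$ such that $P^{\mathsf T}SP$ is diagonal for all $S\in\mathcal{S}$. The set $\mathcal{C}$ is $\mathbf{D}_{m,n}$-SD if there exist $P\in\mathrm{RSL}(m,n)$ and diagonal matrices $D^{(1)},\dots,D^{(L)}\in\mathbb{R}^{n\times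 n}$ such that $A_i=P^{\mathsf T}D^{(i)}P$ for all $1\le i\le L$. *)

(* Defs.v *)
From HB Require Import structures.
From mathcomp Require Import all_boot all_order all_algebra.
From mathcomp Require Import all_classical all_reals.

Set Implicit Arguments.
Unset Strict Implicit.
Unset Printing Implicit Defensive.

Import Order.TTheory GRing.Theory Num.Theory.

Local Open Scope classical_set_scope.
Local Open Scope ring_scope.

Definition Sym (R : realType) (n : nat) : set 'M[R]_n :=
  [set A | A^T = A].

Definition SL (R : realType) (m : nat) : set 'M[R]_m :=
  [set A | \det A = 1].

Definition RSL (R : realType) (m n : nat) : set 'M[R]_(n, m) :=
  [set P | SL (P^T *m P)].

(* For m <= n, [pid_mx m] is the n x m matrix whose columns are the first m
   standard basis vectors of R^n. *)
Definition Imn (R : realType) (m n : nat) : 'M[R]_(n, m) := pid_mx m.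

Definition rho (R : realType) (m n : nat) (X : 'M[R]_(n, m)) (B : 'M[R]_n) :
  'M[R]_m := X^T *m B *m X.

Definition SD (R : realType) (n : nat) (S : set 'M[R]_n) : Prop :=
  exists2 P : 'M[R]_n, SL P & forall B, S B -> is_diag_mx (P^T *m B *m P).

(* Simultaneous diagonalizability of the indexed set {A_i}. *)
Definition D_SD (R : realType) (m n L : nat) (A : 'I_L -> 'M[R]_m) : Prop :=
  exists (P : 'M[R]_(n, m)) (D : 'I_L -> 'M[R]_n),
    [/\ RSL P, forall i, is_diag_mx (D i) & forall i, A i = P^T *m D i *m P].
Arguments D_SD {R m} n {L} A.

(* Main.v *)
Require Import Defs.
From mathcomp Require Import all_boot all_order all_algebra.
From mathcomp Require Import all_classical all_reals.

(** Both equivalences rest on changes of variables, and the only care needed is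
    with the determinant normalizations.

    From (i) to (ii), the diagonal matrices D^(i) themselves form an SD set,
    and X = P.

    From (ii) to (iii), a matrix X in RSL(m,n) has full column rank, so it is
    formed by the first m columns of some invertible Q ([column_completion]).
    Congruence by Q moves X to I_{m,n}, and it turns a diagonalizer P of the set
    into Q^-1 P.  The determinant of Q^-1 P need not be 1 (for n = m it may be
    -1), but rescaling one column of a diagonalizer keeps the congruent matrices
    diagonal, so any invertible diagonalizer is good enough ([SD_unitmx]).

    From (iii) to (i), if P diagonalizes the set then the first m columns X of
    P^-1 satisfy X^T (P^T B P) X = rho_{I_{m,n}}(B).  The Gram determinant of X
    is positive ([det_posdef_gt0]), hence replacing X by c X and each diagonal
    D by c^-2 D, for c a suitable root of the inverse of that determinant, puts
    X in RSL(m,n) ([RSL_normalization]). *)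

Set Implicit Arguments.
Unset Strict Implicit.
Unset Printing Implicit Defensive.

Import Order.TTheory GRing.Theory Num.Theory.

Local Open Scope classical_set_scope.
Local Open Scope ring_scope.

Lemma exists_expr_root (R : rcfType) (k : nat) (a : R) :
  (0 < k)%N -> 0 <= a -> exists2 c : R, 0 <= c & c ^+ k = a.
Proof.
move=> k0 a0.
have h0 : ('X^k - a%:P).[0] <= 0.
  by rewrite !hornerE expr0n -[_ == _]negbK -lt0n k0 /= sub0r oppr_le0.
have h1 : 0 <= ('X^k - a%:P).[1 + a].
  rewrite !hornerE subr_ge0; apply: (@le_trans _ _ (1 + a)).
    by rewrite lerDr.
  by rewrite ler_eXnr // lerDl.
have [|c /andP[c0 _] /rootP] := @poly_ivt _ ('X^k - a%:P) _ _ (addr_ge0 ler01 a0).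
  by rewrite h0 h1.
by rewrite !hornerE => /eqP; rewrite subr_eq0 => /eqP ck; exists c.
Qed.

Lemma sqr_rV_gt0 (R : realDomainType) (n : nat) (v : 'rV[R]_n) :
  v != 0 -> 0 < (v *m v^T) 0 0.
Proof.
move=> /rV0Pn[j vj]; rewrite mxE (bigD1 j) //= mxE.
apply: ltr_wpDr; last by rewrite -expr2 exprn_even_gt0.
by apply: sumr_ge0 => i _; rewrite mxE -expr2 sqr_ge0.
Qed.

(** The segment from the identity to a positive definite G consists of positive
    definite, hence nonsingular, matrices.  The determinant along the segment is
    a polynomial without roots on [0, 1] with value 1 at 0, so it is still
    positive at G by the intermediate value theorem. *)
Lemma det_posdef_gt0 (R : rcfType) (m : nat) (G : 'M[R]_m) :
  (forall v : 'rV_m, v != 0 -> 0 < (v *m G *m v^T) 0 0) -> 0 < \det G.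
Proof.
move=> Gpos; rewrite ltNge; apply/negP => detG.
pose p : {poly R} := \det ('X *: map_mx polyC G + (1 - 'X) *: 1%:M).
have pE t : p.[t] = \det (t *: G + (1 - t) *: 1%:M).
  rewrite /p -[LHS]/(horner_eval t _) -det_map_mx; congr (\det _).
  by apply/matrixP => i j; rewrite !mxE /= /horner_eval !hornerE hornerMn hornerC.
have [||t /andP[t0 t1]] := @poly_ivt _ (- p) 0 1.
- exact: ler01.
- rewrite !hornerN !pE scale0r add0r subr0 !scale1r subrr scale0r addr0 det1.
  by rewrite oppr_ge0 detG oppr_le0 ler01.
rewrite rootN => /rootP; rewrite pE => /eqP /det0P[v v0].
move=> /(congr1 (fun w => (w *m v^T) 0 0)).
rewrite mulmxDr mulmxDl -!scalemxAr -!scalemxAl mulmx1 mul0mx.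
rewrite [LHS]mxE [X in X + _]mxE [X in _ + X]mxE [RHS]mxE => /eqP.
have Gv := Gpos _ v0; have vv := sqr_rV_gt0 v0.
apply/negP; rewrite gt_eqF //.
have [->|tn0] := eqVneq t 0; first by rewrite mul0r add0r subr0 mul1r.
apply: ltr_wpDr; first by rewrite mulr_ge0 ?subr_ge0 // ltW.
by rewrite mulr_gt0 // lt_def tn0.
Qed.

Lemma det_gram_gt0 (R : rcfType) (m n : nat) (X : 'M[R]_(n, m)) :
  \rank X = m -> 0 < \det (X^T *m X).
Proof.
move=> rX; apply: det_posdef_gt0 => v v0.
have -> : v *m (X^T *m X) *m v^T = (v *m X^T) *m (v *m X^T)^T.
  by rewrite trmx_mul trmxK !mulmxA.
by apply: sqr_rV_gt0; rewrite mulmx_free_eq0 // /row_free mxrank_tr rX.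
Qed.

Lemma RSL_rank (R : realType) (m n : nat) (X : 'M[R]_(n, m)) :
  RSL X -> \rank X = m.
Proof.
move=> detX; apply/eqP; rewrite eqn_leq rank_leq_col /=.
have /mxrank_unit {1}<- : X^T *m X \in unitmx.
  by rewrite unitmxE (detX : \det _ = 1) unitr1.
exact: mxrankM_maxr.
Qed.

Lemma RSL_normalization (R : realType) (m n : nat) (X : 'M[R]_(n, m)) :
  \rank X = m -> exists2 c : R, c != 0 & RSL (c *: X).
Proof.
case: m X => [|m] X rX.
  by exists 1; [exact: oner_neq0 | rewrite /RSL /SL /= det_mx00].
have d0 := det_gram_gt0 rX.
have dV0 : 0 < (\det (X^T *m X))^-1 by rewrite invr_gt0.
(* Scaling X by c multiplies its Gram determinant by c^(2k), k being the number
   of columns of X. *)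
have [||c _ cE] := @exists_expr_root _ (2 * m.+1) (\det (X^T *m X))^-1 => //.
  exact: ltW.
exists c; first by apply/eqP => c0; move: dV0; rewrite -cE c0 expr0n ltxx.
rewrite /RSL /SL /= -scalemxAr [(c *: X)^T]linearZ /= -scalemxAl scalerA -expr2 detZ.
by rewrite -exprM cE mulVf // gt_eqF.
Qed.

Lemma column_completion (F : fieldType) (m n : nat) (X : 'M[F]_(n, m)) :
  (m <= n)%N -> \rank X = m ->
  exists2 Q : 'M[F]_n, Q \in unitmx & Q *m pid_mx m = X.
Proof.
move=> mn rX.
(* The n x n matrix with top rows X^T agrees with X^T on the first m basis rows
   and need not be invertible; an invertible g can replace it there. *)
have [|g] := @complete_unitmx _ _ _ (pid_mx m : 'M[F]_(m, n)) (pid_mx m *m X^T).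
  by rewrite mulmxA pid_mx_id // pid_mx_1 mul1mx mxrank_tr rank_pid_mx.
rewrite mulmxA pid_mx_id // pid_mx_1 mul1mx => gU gE.
exists g^T; first by rewrite unitmx_tr.
by rewrite -[X]trmxK gE trmx_mul tr_pid_mx.
Qed.

Lemma rho_mulmx (R : realType) (m n : nat) (Q : 'M[R]_n) (X : 'M[R]_(n, m))
  (B : 'M[R]_n) : rho (Q *m X) B = rho X (rho Q B).
Proof. by rewrite /rho trmx_mul !mulmxA. Qed.

Lemma rho_Sym (R : realType) (m n : nat) (X : 'M[R]_(n, m)) (B : 'M[R]_n) :
  Sym B -> Sym (rho X B).
Proof.
by rewrite /Sym /rho /= => BT; rewrite !trmx_mul trmxK BT mulmxA.
Qed.

(** Multiplying P on the right by a diagonal matrix rescales its columns, which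
    keeps P^T B P diagonal; the first column absorbs the determinant. *)
Lemma SD_unitmx (R : realType) (n : nat) (S : set 'M[R]_n) (P : 'M[R]_n) :
  P \in unitmx -> (forall B, S B -> is_diag_mx (rho P B)) -> SD S.
Proof.
case: n S P => [|n] S P PU diagP.
  by exists P => //; rewrite /SL /= det_mx00.
pose E := diag_mx (\row_(j < n.+1) if j == 0 then (\det P)^-1 else 1).
exists (P *m E).
  rewrite /SL /= det_mulmx det_diag big_ord_recl big1 => [|i _]; last first.
    by rewrite mxE.
  by rewrite mxE eqxx mulr1 divrr // -unitmxE.
move=> B /diagP /diag_mxP[d dE]; rewrite -[X in is_diag_mx X]/(rho (P *m E) B).
by rewrite rho_mulmx dE /rho tr_diag_mx !mulmx_diag diag_mx_is_diag.
Qed.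

Theorem lemma5p3 (R : realType) (m n L : nat) (hmn : (m <= n)%N)
    (A : 'I_L -> 'M[R]_m) (symA : forall i, Sym (A i)) :
  [<-> (* (i) *)
       D_SD n A;
       (* (ii) *)
       exists (X : 'M[R]_(n, m)) (S : set 'M[R]_n),
         [/\ RSL X, S `<=` @Sym R n, SD S & rho X @` S = range A];
       (* (iii) *)
       exists S : set 'M[R]_n,
         [/\ S `<=` @Sym R n, SD S & rho (Imn R m n) @` S = range A]].
Proof.
tfae.
- move=> [P [D [PRSL Ddiag AE]]]; exists P, (range D); split=> //.
  + by move=> _ [i _ <-]; have /diag_mxP[d ->] := Ddiag i; exact: tr_diag_mx.
  + apply: (@SD_unitmx _ _ _ 1%:M); first exact: unitmx1.
    by move=> _ [i _ <-]; rewrite /rho trmx1 mul1mx mulmx1.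
  + rewrite image_comp; apply: eq_imagel => i _.
    by rewrite /= /rho AE.
- move=> [X [S [XRSL Ssym [P detP diagP] SE]]].
  have [Q QU QE] := column_completion hmn (RSL_rank XRSL).
  exists (rho Q @` S); split.
  + by move=> _ [B SB <-]; exact/rho_Sym/Ssym.
  + apply: (@SD_unitmx _ _ _ (invmx Q *m P)).
      by rewrite unitmx_mul unitmx_inv QU unitmxE (detP : \det P = 1) unitr1.
    by move=> _ [B SB <-]; rewrite -rho_mulmx mulmxA mulmxV // mul1mx diagP.
  + by rewrite -SE -QE image_comp; apply: eq_imagel => B _; rewrite rho_mulmx.
- move=> [S [_ [P detP diagP] SE]].
  have PU : P \in unitmx by rewrite unitmxE (detP : \det P = 1) unitr1.
  pose X := invmx P *m Imn R m n.
  have rX : \rank X = m.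
    rewrite -mxrank_tr trmx_mul mxrankMfree ?mxrank_tr ?rank_pid_mx //.
    by rewrite row_free_unit unitmx_tr unitmx_inv.
  have [c c0 cX] := RSL_normalization rX.
  have /boolp.choice[B BP] i : exists B, S B /\ rho (Imn R m n) B = A i.
    have : range A (A i) by exists i.
    by rewrite -SE => -[B SB BE]; exists B.
  exists (c *: X), (fun i => c ^- 2 *: rho P (B i)); split=> // i.
  + have [/diagP /diag_mxP[d dE] _] := BP i.
    by rewrite /rho dE -linearZ; exact: diag_mx_is_diag.
  + have [_ <-] := BP i.
    rewrite [(c *: X)^T]linearZ /= -!scalemxAl -!scalemxAr -!scalemxAl !scalerA.
    rewrite mulrA -expr2 divff ?expf_neq0 // scale1r.
    rewrite -/(rho X _) -rho_mulmx; congr (rho _ _).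
    by rewrite mulKVmx.
Qed.
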